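(* Let $\mathcal{A}$ be a finite alphabet and let $X\subseteq\mathcal{A}^{\mathbb{Z}}$ be a (nonempty) language stable subshift. Then $X$ supports a characteristic measure, i.e. there is a Borel probability measure $\mu$ on $X$ such that $\psi_*\mu=\mu$ for every $\psi\in\mathrm{Aut}(X)$.
   Context: A subshift is a closed subset $X\subseteq\mathcal{A}^{\mathbb{Z}}$ (product topology, $\mathcal{A}$ finite) that is invariant under the left shift $(\sigma x)_i=x_{i+1}$. $\mathrm{Aut}(X)$ is the group of homeomorphisms $\psi\colon X\to X$ with $\psi\sigma=\sigma\psi$. The language $\mathcal{L}(X)$ is the set of finite words over $\mathcal{A}$ that occur as a block of consecutive symbols in some element of $X$. A minimal forbidden word of $X$ is a finite word $w\notin\mathcal{L}(X)$ all of whose proper subwords (blocks of consecutive letters) lie in $\mathcal{L}(X)$; $\mathcal{M}_n(X)$ is the set of minimal forbidden words of length $n$. The upper Banach density of $S\subseteq\mathbb{N}$ is $d^*(S)=\limsup_{n\to\infty}\max_k |S\cap\{k,k+1,\dots,k+n-1\}|/n$ (so $d^*(S)=1$ iff $S$ contains arbitrarily long runs of consecutive integers). $X$ is language stable if $\{n\in\mathbb{N}\colon\mathcal{M}_n(X)=\emptyset\}$ has upper Banach density $1$. *)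

(* Defs.v *)
From HB Require Import structures.
From mathcomp Require Import all_boot all_order all_algebra.
From mathcomp Require Import all_classical all_reals all_analysis.

Set Implicit Arguments.
Unset Strict Implicit.
Unset Printing Implicit Defensive.

Import Order.TTheory GRing.Theory Num.Theory.
Import numFieldNormedType.Exports.

Local Open Scope classical_set_scope.
Local Open Scope ring_scope.

Definition fullshift (A : finType) : topologicalType :=
  {ptws int -> discrete_topology A}.

Definition shift (A : finType) (x : fullshift A) : fullshift A :=
  fun i : int => x (i + 1).

(* Shift invariance is the equality [shift X = X], not just [shift X `<=` X]. *)
Record subshift (A : finType) := Subshift {
  subshift_set :> set (fullshift A);
  subshift_closed : closed subshift_set;
  subshift_invariant : @shift A @` subshift_set = subshift_set
}.

Lemma subshift_shift (A : finType) (X : subshift A) (x : X) :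
  shift (set_val x) \in (X : set (fullshift A)).
Proof.
have sXX : @shift A @` X `<=` X by rewrite subshift_invariant.
by apply/mem_set/sXX; exists (set_val x) => //; exact: set_valP.
Qed.

Definition shift_on (A : finType) (X : subshift A) (x : X) : X :=
  exist _ (shift (set_val x)) (subshift_shift x).

Definition homeomorphism (T U : topologicalType) (f : T -> U) : Prop :=
  continuous f /\
  exists g : U -> T, [/\ continuous g, cancel f g & cancel g f].

(* [X] stands for the subtype [set_type X], which the library endows with the
   topology induced by the product topology of [fullshift A]. *)
Definition automorphism (A : finType) (X : subshift A) (psi : X -> X) : Prop :=
  homeomorphism psi /\ psi \o @shift_on A X =1 @shift_on A X \o psi.

Definition language (A : finType) (X : subshift A) : set (seq A) :=
  [set w | exists (x : X) (i : int),
    w = mkseq (fun j : nat => set_val x (i + j%:Z)) (size w)].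

(* [infix u w] says that [u] is a block of consecutive letters of [w]. *)
Definition minimal_forbidden (A : finType) (X : subshift A) (n : nat) :
    set (seq A) :=
  [set w | [/\ size w = n, ~ language X w &
    forall u : seq A, infix u w -> u != w -> language X u]].

Definition window_count (S : set nat) (n k : nat) : nat :=
  count (fun m : nat => `[< S m >]) (iota k n).

(* The inner supremum is a maximum, since [window_count S n k] is an integer
   between 0 and n; the irrelevant term n = 0 of the sequence is 0. *)
Definition upper_banach_density (R : realType) (S : set nat) : R :=
  limn_sup (fun n : nat =>
    sup [set (window_count S n k)%:R / n%:R | k in [set: nat]]).

Definition language_stable (R : realType) (A : finType) (X : subshift A) :
    Prop :=
  upper_banach_density R [set n | minimal_forbidden X n = set0] = 1.

(* A measurable type must be pointed: [points X X0] is the space [X], pointed by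
   means of the proof [X0] that it is nonempty. *)
Definition points (A : finType) (X : subshift A) (X0 : (X : set _) !=set0) :
  Type := X.

HB.instance Definition _ (A : finType) (X : subshift A)
  (X0 : (X : set _) !=set0) := Topological.on (points X0).

HB.instance Definition _ (A : finType) (X : subshift A)
    (X0 : (X : set _) !=set0) :=
  isPointed.Build (points X0)
    (exist _ (projT1 (cid X0)) (mem_set (projT2 (cid X0)))).

Definition borel (A : finType) (X : subshift A) (X0 : (X : set _) !=set0) :=
  g_sigma_algebraType (@open (points X0)).

(* Main.v *)
(* Let X_n be the shift of finite type of the sequences all of whose n-words
   occur in X. If X has no minimal forbidden word of length in (n, n + k], then
   X_n = X_(n+k), so a block code of small radius that acts on X also acts, and
   is injective, on the finite nonempty set of p-periodic points of X_n, for a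
   suitable p. Density 1 provides such n with k arbitrarily large. Choosing for
   each of these periodic points a point of X that agrees with it on a long
   central window turns the uniform measures into finitely additive means on all
   subsets of X; for k large, no automorphism of X increases the mean of a given
   clopen set by pulling it back. A limit along an ultrafilter is exactly
   invariant on clopen sets, by passing to complements; by compactness it is
   countably additive there, so it extends to a Borel measure. *)
Require Import Defs.
From HB Require Import structures.
From mathcomp Require Import all_boot all_order all_algebra.
From mathcomp Require Import zify.
From mathcomp Require Import all_classical all_reals all_analysis.

Set Implicit Arguments.
Unset Strict Implicit.
Unset Printing Implicit Defensive.

Import Order.TTheory GRing.Theory Num.Theory.
Import numFieldNormedType.Exports.

Local Open Scope classical_set_scope.
Local Open Scope ring_scope.

(** * Window topology *)

Definition agree (A : Type) (n : nat) (x y : int -> A) : Prop :=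
  forall i : int, (absz i <= n)%N -> x i = y i.

Lemma agree_sym (A : Type) n (x y : int -> A) : agree n x y -> agree n y x.
Proof. by move=> xy i /xy. Qed.

Lemma agree_trans (A : Type) n (x y z : int -> A) :
  agree n x y -> agree n y z -> agree n x z.
Proof. by move=> xy yz i ni; rewrite xy ?yz. Qed.

Lemma agree_le (A : Type) m n (x y : int -> A) :
  (m <= n)%N -> agree n x y -> agree m x y.
Proof. by move=> mn xy i im; apply: xy; exact: leq_trans mn. Qed.

Lemma near_coord (A : finType) (x : fullshift A) (i : int) :
  \forall y \near x, x i = y i.
Proof.
have /(_ x [set a | x i = a]) :=
  @proj_continuous int (fun=> discrete_topology A) i.
by apply; rewrite nbhs_principalE.
Qed.

Lemma near_agree (A : finType) (x : fullshift A) n :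
  \forall y \near x, agree n x y.
Proof.
elim: n => [|n IHn].
  near=> y => i; rewrite leqn0 absz_eq0 => /eqP ->.
  by near: y; exact: near_coord.
near=> y => i; rewrite leq_eqVlt ltnS => /predU1P[|]; last first.
  by move: i; near: y.
by case: (intP i) => [|j|j] //= [->]; near: y; exact: near_coord.
Unshelve. all: by end_near. Qed.

(** Points outside [U] that agree with [x] on ever larger windows would converge to [x] in every
    coordinate, hence in the product topology. *)
Lemma nbhs_agree (A : finType) (x : fullshift A) (U : set (fullshift A)) :
  nbhs x U -> exists n, forall y, agree n x y -> U y.
Proof.
move=> xU; apply: contrapT => /forallNP nU.
have {nU} /choice[y yP] : forall n, exists y : fullshift A,
    agree n x y /\ ~ U y.
  by move=> n; move/existsNP : (nU n) => [y /not_implyP]; exists y.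
have : y @ \oo --> x.
  apply/cvg_sup => i V [W [[B oB <-] Bx BV]].
  apply: (filterS BV).
  by exists (absz i) => // n /= ni; rewrite -(yP n).1.
by move=> /(_ _ xU)[n _ /(_ n (leqnn n))]; exact: (yP n).2.
Qed.

Section SubshiftTopology.
Context (A : finType) (X : subshift A).

Definition sagree n (x y : X) := agree n (set_val x) (set_val y).

Lemma near_sagree (x : X) n : \forall y \near x, sagree n x y.
Proof.
apply: (@initial_continuous _ _ set_val x).
exact: (near_agree (set_val x) n).
Qed.

Lemma nbhs_sagree (x : X) (U : set X) :
  nbhs x U -> exists n, forall y, sagree n x y -> U y.
Proof.
move=> [_ [[V oV <-] Vx VU]].
have [n nV] := @nbhs_agree _ _ V (open_nbhs_nbhs (conj oV Vx)).
by exists n => y xy; apply: VU; exact: nV.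
Qed.

Lemma subshift_compact : compact [set: X].
Proof.
move=> F PF _.
have cX : compact (X : set (fullshift A)).
  apply: (subclosed_compact (@subshift_closed A X)
    (@tychonoff int (fun=> discrete_topology A) (fun=> setT) _)) => //.
  move=> _.
  exact: (@finite_compact (discrete_topology A) _ (@finite_finset A setT)).
have [|x [/mem_set Xx Fx]] := cX _ (@fmap_proper_filter _ _ set_val F PF).
  by apply: (@filterS _ F _ setT) => [x _|]; [exact: set_valP|exact: filterT].
exists (exist _ x Xx); split => // B U FB [_ [[V oV <-] Vx /= VU]].
have [_ [[y By <-] Vy]] : (set_val @` B) `&` V !=set0.
  apply: Fx; last exact: open_nbhs_nbhs.
  by apply: (@filterS _ F _ B) => // y By; exists y.
by exists y; split=> //; exact: VU.
Qed.

(** Compactness makes a pointwise window radius uniform; this serves both countable additivity and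
    block codes. *)
Lemma sagree_compact (P : nat -> X -> Prop) :
  (forall x, exists n, forall m y, (n <= m)%N -> sagree n x y -> P m y) ->
  exists n, forall m y, (n <= m)%N -> P m y.
Proof.
move=> xP; have /compact_near_coveringP := subshift_compact.
move=> /(_ nat \oo (fun n y => P n y) _)[x _|n _ nP].
  have [n nP] := xP x.
  exists ([set y | sagree n x y], [set m | (n <= m)%N]) => /=.
    by split; [exact: near_sagree|exists n].
  by move=> [y m] /= [xy nm]; exact: nP.
by exists n => m y /nP; exact.
Qed.

End SubshiftTopology.

(** * Extension of finitely additive means *)

Section WindowSets.
Context (A : finType) (X : subshift A).

(** By compactness these are exactly the clopen sets. One implication suffices, since [sagree] is
    symmetric. *)
Definition windowed (C : set X) : Prop :=
  exists n, forall x y, sagree n x y -> C x -> C y.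

Lemma windowed0 : windowed set0.
Proof. by exists 0%N. Qed.

Lemma windowedU : setU_closed windowed.
Proof.
move=> C D [m mC] [n nD]; exists (maxn m n) => x y xy [Cx|Dx].
  by left; apply: mC Cx; apply: agree_le xy; exact: leq_maxl.
by right; apply: nD Dx; apply: agree_le xy; exact: leq_maxr.
Qed.

Lemma windowedC : setC_closed windowed.
Proof. by move=> C [n nC]; exists n => x y /agree_sym xy Cx /(nC _ _ xy). Qed.

Lemma windowed_open (C : set X) : windowed C -> open C.
Proof.
move=> [n nC]; rewrite openE => x Cx.
have := near_sagree x n; apply: filterS => y xy; exact: nC Cx.
Qed.

Lemma open_bigcup_windowed (O : set X) : open O ->
  exists2 F : nat -> set X, forall n, windowed (F n) & O = \bigcup_n F n.
Proof.
move=> oO; exists (fun n => [set x | forall y, sagree n x y -> O y]).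
  by move=> n; exists n => x y xy /= xO z yz; apply: xO; exact: agree_trans yz.
apply/seteqP; split => [x Ox|x [n _]]; last by apply.
by have [n nO] := nbhs_sagree (open_nbhs_nbhs (conj oO Ox)); exists n.
Qed.

Lemma sigma_windowed : <<s windowed >> = <<s @open X >>.
Proof.
apply/seteqP; split; apply: smallest_sub; try exact: smallest_sigma_algebra.
  by move=> C /windowed_open oC; exact: sub_sigma_algebra.
move=> _ /open_bigcup_windowed[F wF ->].
have [_ _] := smallest_sigma_algebra setT windowed; apply=> n.
exact: sub_sigma_algebra.
Qed.

(** A separate copy of [X], to carry the algebra of window sets next to the Borel structure of
    [borel X0]. *)
Definition window_space (X0 : (X : set (fullshift A)) !=set0) : Type :=
  points X0.

HB.instance Definition _ X0 := Pointed.on (window_space X0).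

HB.instance Definition _ X0 := isAlgebraOfSets.Build default_measure_display
  (window_space X0) windowed0 windowedU windowedC.

End WindowSets.

Section Extension.
Context (R : realType) (A : finType) (X : subshift A).
Context (X0 : (X : set (fullshift A)) !=set0).
Context (m : set X -> R) (m_ge0 : forall C, 0 <= m C).
Context (mT : m setT = 1).
Context (mU : forall C D, C `&` D = set0 -> m (C `|` D) = m C + m D).

Let m0 : m set0 = 0.
Proof.
by have := mU (setI0 set0); rewrite setU0 -[LHS]addr0 => /addrI.
Qed.

Definition window_content (C : set (window_space X0)) : \bar R := (m C)%:E.

Let window_content0 : window_content set0 = 0%E.
Proof. by rewrite /window_content m0. Qed.

Let window_content_ge0 C : (0 <= window_content C)%E.
Proof. by rewrite lee_fin. Qed.

Let window_content_sigma_additive : semi_sigma_additive window_content.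
Proof.
move=> F wF tF [N NF].
have sumF n : (\sum_(0 <= i < n) window_content (F i) =
    window_content (\bigcup_(i < n) F i))%E.
  elim: n => [|n IHn]; first by rewrite big_nil II0 bigcup_set0.
  rewrite big_nat_recr//= IHn IIS bigcup_setU bigcup_set1.
  rewrite /window_content mU ?EFinD//.
  apply/seteqP; split => // x [[i /= ltin Fix] Fnx].
  have in_ : i = n by apply: tF => //; exists x.
  by rewrite in_ ltnn in ltin.
(* By compactness finitely many [F i] already cover the union, so the partial sums are eventually
   constant. Near a point outside the union the claim is vacuous, because the union is itself
   windowed, of radius [N]. *)
have [n nF] : exists n, forall k x, (n <= k)%N ->
    (\bigcup_i F i) x -> exists2 i, (i < k)%N & F i x.
  apply: (@sagree_compact _ X) => x.
  have [[i _ Fix]|nFx] := pselect ((\bigcup_i F i) x).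
    have [w wFi] := wF i; exists (maxn i.+1 w) => k y + xy _.
    rewrite geq_max => /andP[ik wk]; exists i => //.
    by apply: wFi Fix; apply: agree_le xy; exact: leq_maxr.
  by exists N => k y _ xy /(NF _ _ (agree_sym xy)).
apply: cvg_near_cst; exists n => // k /= nk.
rewrite sumF; congr window_content; apply/seteqP; split.
  by apply: bigcup_sub => i _; exact: bigcup_sup.
by move=> x /(nF k x nk)[i]; exists i.
Qed.

HB.instance Definition _ := isMeasure.Build _ _ _ window_content
  window_content0 window_content_ge0 window_content_sigma_additive.

(** The Caratheodory extension, retyped on the Borel sets, which [sigma_windowed] identifies with
    the sigma-algebra that window sets generate. *)
Definition window_measure : set (borel X0) -> \bar R :=
  measure_extension window_content.

Let window_measure_sigma_additive : semi_sigma_additive window_measure.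
Proof.
have E : @measurable _ (borel X0) = <<s @windowed A X >>.
  by rewrite sigma_windowed.
move=> F mF tF mUF; apply: (measure_semi_sigma_additive
  (s := measure_extension window_content)) => //.
- by move=> i; have := mF i; rewrite E.
- by move: mUF; rewrite E.
Qed.

HB.instance Definition _ := isMeasure.Build _ _ _ window_measure
  (measure0 (measure_extension window_content))
  (measure_ge0 (measure_extension window_content))
  window_measure_sigma_additive.

Lemma window_measureE (C : set X) : windowed C -> window_measure C = (m C)%:E.
Proof.
move=> wC.
by rewrite /window_measure/= /measure_extension measurable_mu_extE.
Qed.

Let window_measureT : window_measure setT = 1%E.
Proof. by rewrite window_measureE ?mT//; exists 0%N. Qed.

HB.instance Definition _ := Measure_isProbability.Build _ _ _ window_measure
  window_measureT.

Lemma window_extension : exists mu : probability (borel X0) R,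
  forall C, windowed C -> mu C = (m C)%:E.
Proof. by exists window_measure; exact: window_measureE. Qed.

End Extension.

(** * Block codes and finite-type approximations *)

Definition translate (A : finType) (k : int) (x : fullshift A) : fullshift A :=
  fun i => x (i + k).

Section Translate.
Context (A : finType) (X : subshift A).

Lemma subshift_translate (k : int) (x : fullshift A) :
  (X : set _) x -> (X : set _) (translate k x).
Proof.
have sX : @Defs.shift A @` X = X := subshift_invariant X.
elim/int_ind : k x => [x|n IHn x Xx|n IHn x Xx].
- rewrite (_ : translate 0 x = x)//; apply/funext => i.
  by rewrite /translate addr0.
- rewrite -sX; exists (translate n x); first exact: IHn.
  by apply/funext => i; rewrite /Defs.shift /translate; congr x; lia.
(* A backward step uses that the shift maps [X] onto itself. *)
- have [y Xy yx] : (@Defs.shift A @` X) (translate (- n%:Z) x).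
    by rewrite sX; exact: IHn.
  suff -> : translate (- n.+1%:Z) x = y by [].
  apply/funext => i; have /(congr1 (@^~ (i - 1))) := yx.
  by rewrite /Defs.shift /translate subrK => ->; congr x; lia.
Qed.

Definition translate_on (k : int) (x : X) : X :=
  exist _ (translate k (set_val x))
    (mem_set (subshift_translate k (set_valP x))).

Lemma subshift_ext (x y : X) : set_val x =1 set_val y -> x = y.
Proof. by move=> /funext xy; exact: val_inj. Qed.

Lemma shift_onE (x : X) i : set_val (shift_on x) i = set_val x (i + 1).
Proof. by []. Qed.

Lemma translate_onE k (x : X) i :
  set_val (translate_on k x) i = set_val x (i + k).
Proof. by []. Qed.

Lemma shift_on_inj : injective (@shift_on A X).
Proof.
move=> x y /(congr1 set_val) xy; apply: subshift_ext => i.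
by have /(congr1 (@^~ (i - 1))) := xy; rewrite /= !shift_onE subrK.
Qed.

Lemma shift_on_translate k (x : X) :
  shift_on (translate_on k x) = translate_on (k + 1) x.
Proof.
apply: subshift_ext => i; rewrite shift_onE !translate_onE.
by congr (set_val x _); lia.
Qed.

Lemma commute_translate (psi : X -> X) :
  psi \o @shift_on A X =1 @shift_on A X \o psi ->
  forall k x, psi (translate_on k x) = translate_on k (psi x).
Proof.
move=> psiS; have translate0 x : translate_on 0 x = x.
  by apply: subshift_ext => i; rewrite translate_onE addr0.
elim/int_ind => [x|n IHn x|n IHn x]; first by rewrite !translate0.
  rewrite -addn1 PoszD -!shift_on_translate.
  by rewrite [LHS]psiS /= IHn.
apply: shift_on_inj; rewrite -[LHS]psiS /= !shift_on_translate.
by rewrite (_ : - n.+1%:Z + 1 = - n%:Z)//; lia.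
Qed.

(** Half of the Curtis-Hedlund-Lyndon theorem: continuity gives a radius at each point, compactness
    a common one. *)
Lemma continuous_block_code (psi : X -> X) : continuous psi ->
  exists s, forall x y, sagree s x y -> set_val (psi x) 0 = set_val (psi y) 0.
Proof.
move=> cpsi; have [s Ps] : exists s, forall m x, (s <= m)%N ->
    forall y, sagree m x y -> set_val (psi x) 0 = set_val (psi y) 0.
  apply: (@sagree_compact _ X) => x.
  have /nbhs_sagree[w xw] : \forall y \near x, sagree 0 (psi x) (psi y).
    by apply: cpsi; exact: near_sagree.
  exists w => m y wm xy z yz.
  rewrite -(xw y xy 0 isT) (xw z _ 0 isT)//.
  by apply: agree_trans xy _; exact: agree_le yz.
by exists s => x y; exact: Ps.
Qed.

Lemma sagree_block_code (psi : X -> X) s w :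
  psi \o @shift_on A X =1 @shift_on A X \o psi ->
  (forall x y, sagree s x y -> set_val (psi x) 0 = set_val (psi y) 0) ->
  forall x y, sagree (s + w) x y -> sagree w (psi x) (psi y).
Proof.
move=> psiS psis x y xy i iw.
have psiE z : set_val (psi z) i = set_val (psi (translate_on i z)) 0.
  by rewrite (commute_translate psiS) translate_onE add0r.
rewrite !psiE; apply: psis => j js; rewrite !translate_onE; apply: xy; lia.
Qed.

Lemma windowed_preimage (psi : X -> X) (C : set X) :
  continuous psi -> psi \o @shift_on A X =1 @shift_on A X \o psi ->
  windowed C -> windowed (psi @^-1` C).
Proof.
move=> /continuous_block_code[s psis] psiS [w wC].
by exists (s + w)%N => x y xy; apply: wC; exact: (sagree_block_code psiS psis).
Qed.

(* The shift of finite type X_n. *)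
Definition locally (n : nat) (x : fullshift A) : Prop :=
  forall i : int, exists y : X, forall j : nat, (j < n)%N ->
    x (i + j%:Z) = set_val y j%:Z.

Lemma languageP (x : fullshift A) (i : int) (n : nat) :
  language X (mkseq (fun j => x (i + j%:Z)) n) <->
  exists y : X, forall j : nat, (j < n)%N -> x (i + j%:Z) = set_val y j%:Z.
Proof.
split=> [[y [k]]|[y xy]].
  rewrite size_mkseq => E; exists (translate_on k y) => j jn.
  have /(congr1 (fun s => nth (x i) s j)) := E.
  by rewrite !nth_mkseq// => ->; rewrite translate_onE addrC.
exists y, 0; rewrite size_mkseq; apply: (@eq_from_nth _ (x i)).
  by rewrite !size_mkseq.
by move=> j; rewrite size_mkseq => jn; rewrite !nth_mkseq// add0r xy.
Qed.

Lemma locally_le m n x : (m <= n)%N -> locally n x -> locally m x.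
Proof.
move=> mn xn i; have [y xy] := xn i; exists y => j jm; apply: xy.
exact: leq_trans mn.
Qed.

(** Every proper block of an (n+1)-word of [x] has length at most [n], hence lies in the language;
    were the word itself missing, it would be minimal forbidden. *)
Lemma locally_succ n x :
  minimal_forbidden X n.+1 = set0 -> locally n x -> locally n.+1 x.
Proof.
move=> Mn xn i; apply/languageP; set w := mkseq _ _; apply: contrapT => nw.
suff : minimal_forbidden X n.+1 w by rewrite Mn.
split=> [|//|u /infixP[s [t wE]] uw]; first by rewrite size_mkseq.
have sE : (size s + (size u + size t) = n.+1)%N.
  by rewrite -!size_cat -wE size_mkseq.
have un : (size u <= n)%N.
  rewrite leqNgt; apply: contra uw => nu.
  have s0 : size s = 0%N by lia.
  have t0 : size t = 0%N by lia.
  by rewrite wE (size0nil s0) (size0nil t0) cats0.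
have -> : u = mkseq (fun j => x (i + (size s)%:Z + j%:Z)) (size u).
  apply: (@eq_from_nth _ (x i)); first by rewrite size_mkseq.
  move=> j ju; rewrite nth_mkseq//.
  have := congr1 (fun v => nth (x i) v (size s + j)) wE.
  rewrite /= nth_mkseq; last first.
    by rewrite -sE ltn_add2l; exact: leq_trans ju (leq_addr _ _).
  by rewrite nth_cat ltnNge leq_addr/= addKn nth_cat ju -addrA => <-.
by apply/languageP; exact: locally_le un xn _.
Qed.

Lemma locally_run n k x :
  (forall j, (n < j <= n + k)%N -> minimal_forbidden X j = set0) ->
  locally n x -> locally (n + k) x.
Proof.
elim: k => [|k IHk] Mn xn; first by rewrite addn0.
rewrite addnS; apply: locally_succ; first by apply: Mn; lia.
by apply: IHk => // j jnk; apply: Mn; lia.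
Qed.

Lemma locally_agree n r x : locally n x -> (r.*2 < n)%N ->
  forall i, exists y : X, agree r (translate i x) (set_val y).
Proof.
move=> xn rn i; have [y xy] := xn (i - r%:Z).
exists (translate_on r y) => j jr; rewrite translate_onE /translate.
have jr0 : (absz (j + r%:Z))%:Z = j + r%:Z by lia.
have := xy (absz (j + r%:Z)); rewrite jr0.
move=> <-; [by congr x; lia|lia].
Qed.

End Translate.

(** * Block codes acting outside [X] *)

Section BlockExtension.
Context (A : finType) (X : subshift A) (n s : nat) (rho : fullshift A -> X).
Context (sn : (s.*2.*2 < n)%N).
Context (rhoP : forall x, locally X n x -> agree n.-1./2 x (set_val (rho x))).

Lemma locally_translate m k x : locally X m x -> locally X m (translate k x).
Proof.
move=> xm i; have [y xy] := xm (i + k); exists y => j jm; rewrite -xy//.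
by rewrite /translate addrAC.
Qed.

(* The block code of [psi], read off [psi] itself by means of the points of [X]
   that [rho] selects, applied outside [X]. *)
Definition block_extend (psi : X -> X) (x : fullshift A) : fullshift A :=
  fun i => set_val (psi (rho (translate i x))) 0.

Definition block_code (psi : X -> X) : Prop :=
  psi \o @shift_on A X =1 @shift_on A X \o psi /\
  forall x y, sagree s x y -> set_val (psi x) 0 = set_val (psi y) 0.

(** The choices made by [rho] do not matter: the code sees radius [s] only, and there [rho]
    reproduces [x], so any point of [X] that looks like [x] around [c] gives the same symbol. *)
Lemma block_extendE psi x y c i : block_code psi -> locally X n x ->
  (forall j : int, (absz j <= s)%N -> x (c + j) = set_val y (i + j)) ->
  block_extend psi x c = set_val (psi y) i.
Proof.
move=> [psiS psis] xn xy.
have -> : set_val (psi y) i = set_val (psi (translate_on i y)) 0.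
  by rewrite (commute_translate psiS) translate_onE add0r.
apply: psis => j js; rewrite -rhoP.
- by rewrite /translate translate_onE addrC xy// addrC.
- exact: locally_translate.
- by have := sn; lia.
Qed.

(** An n-block of the image depends on an (n+2s)-block of [x], starting [s] places earlier; that
    block occurs in [X], so its image occurs in the image of a point of [X]. *)
Lemma locally_block_extend psi x : block_code psi ->
  locally X (n + s.*2) x -> locally X n (block_extend psi x).
Proof.
move=> psis xn i; have [y xy] := xn (i - s%:Z).
exists (psi (translate_on s y)) => j jn; apply: block_extendE => // [|k ks].
  exact: locally_le (leq_addr _ _) xn.
have jk0 : (absz (j%:Z + k + s%:Z))%:Z = j%:Z + k + s%:Z by lia.
rewrite translate_onE -jk0 -xy; last by lia.
by congr x; lia.
Qed.

(** Decoding is local: radius [2s] of [x] around [c] fixes radius [s] of the image, from which [phi]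
    recovers the symbol at [c]. Both codes are applied to points of [X] only, where [phi] undoes
    [psi]; the window of radius [2s] fits into an n-word because 4s < n. *)
Lemma block_extend_inj psi phi x x' : block_code psi -> block_code phi ->
  cancel psi phi -> locally X n x -> locally X n x' ->
  block_extend psi x = block_extend psi x' -> x = x'.
Proof.
move=> psis phis psiK xn xn' xx'; apply/funext => c.
have [y xy] := locally_agree xn sn c.
have [y' xy'] := locally_agree xn' sn c.
have xE z w : locally X n z -> agree s.*2 (translate c z) (set_val w) ->
    agree s (translate c (block_extend psi z)) (set_val (psi w)).
  move=> zn zw i si; apply: block_extendE => // j js.
  have := zw (i + j); rewrite /translate => <-; last by lia.
  by congr z; lia.
have : sagree s (psi y) (psi y').
  apply: agree_trans (xE _ _ xn' xy').
  by rewrite -xx'; apply/agree_sym/xE.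
move=> /phis.2; rewrite !psiK -(xy 0 isT) -(xy' 0 isT).
by rewrite /translate add0r.
Qed.

(** Both sides coincide with [block_extend psi x] on the window, so up to radius [w] coding commutes
    with the passage to [X] by [rho]. *)
Lemma block_extend_agree psi x w : block_code psi ->
  locally X (n + s.*2) x -> ((w + s).*2 < n)%N ->
  sagree w (psi (rho x)) (rho (block_extend psi x)).
Proof.
move=> psis xn wn i iw; rewrite -rhoP; last by lia.
  symmetry; apply: block_extendE => //.
    exact: locally_le (leq_addr _ _) xn.
  move=> j js; apply: rhoP; last by lia.
  exact: locally_le (leq_addr _ _) xn.
exact: locally_block_extend.
Qed.

Lemma block_extend_periodic psi p x : translate p x = x ->
  translate p (block_extend psi x) = block_extend psi x.
Proof.
move=> xp; apply/funext => i; rewrite /block_extend /translate.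
congr (set_val (psi (rho _)) 0); apply/funext => j; rewrite addrA.
exact: (congr1 (@^~ (j + i)) xp).
Qed.

End BlockExtension.

(** * Periodic points of the approximations *)

Section PeriodicPoints.
Context (A : finType) (X : subshift A).

(** Pigeonhole: among |A|^n + 1 words of length [n] at successive positions of a point of [X], two
    coincide, at [i < j]; repeating the stretch from [i] to [j] gives the periodic point. *)
Lemma exists_periodic n : (X : set (fullshift A)) !=set0 ->
  exists p x, locally X n x /\ translate p.+1%:Z x = x.
Proof.
move=> [x Xx].
pose w (i : 'I_(#|{ffun 'I_n -> A}|.+1)) : {ffun 'I_n -> A} :=
  [ffun j : 'I_n => x (i + j)%:Z].
have /injectivePn[i [j ij wij]] : ~~ injectiveb w.
  apply/negP => /injectiveP /leq_card; by rewrite card_ord ltnn.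
wlog ltij : i j ij wij / (i < j)%N.
  move=> H; have [|ji|ijE] := ltngtP i j; first exact: H.
    by apply: (H j i) => //; rewrite eq_sym.
  by case/eqP: ij; exact: val_inj.
have wE l : (l < n)%N -> x (i + l)%:Z = x (j + l)%:Z.
  by move=> ln; have /ffunP/(_ (Ordinal ln)) := wij; rewrite !ffunE.
pose p := (j - i).-1; have pE : p.+1 = (j - i)%N by rewrite /p; lia.
pose y : fullshift A := fun k => x (i%:Z + (k %% p.+1)%Z).
have yp : translate p.+1%:Z y = y.
  by apply/funext => k; rewrite /translate /y modzDr.
(* The equal n-words at [i] and [j] let [y] follow [x] for [n] symbols beyond its first period; the
   induction covers periods shorter than [n]. *)
have yE (k : nat) : (k < p.+1 + n)%N -> y k = x (i + k)%:Z.
  elim/ltn_ind: k => k IHk kpn; have [kp|pk] := ltnP k p.+1.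
    by rewrite /y modz_small ?PoszD.
  have -> : y k = y (k - p.+1)%N.
    by rewrite -[in RHS]yp /translate -PoszD subnK.
  rewrite IHk; [|lia|lia]; rewrite wE; last by lia.
  by congr x; lia.
exists p, y; split=> // c.
(* Modulo the period, every n-window starts within the first period and so stays in the stretch
   where [y] follows [x]. *)
pose c0 := absz (c %% p.+1)%Z.
have c0E : c0%:Z = (c %% p.+1)%Z by rewrite /c0; lia.
have c0p : (c0 < p.+1)%N by rewrite /c0; lia.
exists (translate_on (i%:Z + c0%:Z) (exist _ x (mem_set Xx))) => l ln.
have -> : y (c + l%:Z) = y (c0 + l)%N.
  by rewrite /y PoszD c0E modzDml.
rewrite yE; last by lia.
by rewrite translate_onE /=; congr x; lia.
Qed.

End PeriodicPoints.

(** * Means over periodic points *)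

Section PeriodicMean.
Context (R : realType) (A : finType) (X : subshift A).
Context (n p : nat) (rho : fullshift A -> X).

(** Coding a periodic sequence by one period puts the periodic points into a finite type, where they
    can be counted. *)
Definition periodic_extend (f : {ffun 'I_p.+1 -> A}) : fullshift A :=
  fun i => f (inord (absz (i %% p.+1)%Z)).

Lemma translate_periodic_extend f :
  translate p.+1%:Z (periodic_extend f) = periodic_extend f.
Proof. by apply/funext => i; rewrite /translate /periodic_extend modzDr. Qed.

Lemma periodic_extendK (x : fullshift A) : translate p.+1%:Z x = x ->
  periodic_extend [ffun j : 'I_p.+1 => x j] = x.
Proof.
move=> xp; apply/funext => i; rewrite /periodic_extend ffunE.
have r0 : (0 <= i %% p.+1)%Z by rewrite modz_ge0.
have rp : (i %% p.+1 < p.+1)%Z by exact: ltz_pmod.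
rewrite inordK; last by lia.
have -> : (absz (i %% p.+1)%Z)%:Z = (i %% p.+1)%Z by lia.
rewrite [in RHS](divz_eq i p.+1) [in RHS]addrC.
move: (i %/ _)%Z (i %% _)%Z => q r {r0 rp}.
elim/int_ind : q => [|q IHq|q IHq]; first by rewrite mul0r addr0.
  rewrite IHq -[in LHS]xp /translate; congr x; lia.
rewrite IHq -[in RHS]xp /translate; congr x; lia.
Qed.

Definition local_periodic : {set {ffun 'I_p.+1 -> A}} :=
  [set f | `[< locally X n (periodic_extend f) >]].

Definition periodic_hits (C : set X) : {set {ffun 'I_p.+1 -> A}} :=
  [set f in local_periodic | `[< C (rho (periodic_extend f)) >]].

(** The image under [rho] of the uniform measure on the (p+1)-periodic points of X_n. *)
Definition periodic_mean (C : set X) : R :=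
  #|periodic_hits C|%:R / #|local_periodic|%:R.

Lemma periodic_mean_ge0 C : 0 <= periodic_mean C.
Proof. by rewrite divr_ge0. Qed.

Lemma periodic_mean_le1 C : periodic_mean C <= 1.
Proof.
have [p0|p0] := posnP #|local_periodic|.
  by rewrite /periodic_mean p0 invr0 mulr0.
rewrite ler_pdivrMr ?ltr0n// mul1r ler_nat; apply: subset_leq_card.
by apply/fintype.subsetP => f; rewrite inE => /andP[].
Qed.

Lemma periodic_meanT x : translate p.+1%:Z x = x -> locally X n x ->
  periodic_mean setT = 1.
Proof.
move=> xp xn; rewrite /periodic_mean (_ : periodic_hits _ = local_periodic).
  rewrite divff// pnatr_eq0 -lt0n card_gt0; apply/set0Pn.
  exists [ffun j : 'I_p.+1 => x j]; rewrite inE periodic_extendK//.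
  exact/asboolP.
apply/setP => f; rewrite inE andb_idr// => _; exact/asboolP.
Qed.

Lemma periodic_meanU C D : C `&` D = set0 ->
  periodic_mean (C `|` D) = periodic_mean C + periodic_mean D.
Proof.
move=> CD; rewrite /periodic_mean -mulrDl -natrD; congr (_%:R / _).
rewrite -cardsUI [X in (_ + X)%N](_ : _ = 0%N) ?addn0.
  congr #|pred_of_set _|; apply/setP => f; rewrite !inE -andb_orr; congr andb.
  exact: asbool_or.
apply/eqP; rewrite cards_eq0; apply/eqP/setP => f; rewrite !inE.
apply/negP => /andP[/andP[_ /asboolP Cf] /andP[_ /asboolP Df]].
suff : set0 (rho (periodic_extend f)) by [].
by rewrite -CD; split.
Qed.

(** The extended code injects the points counted for the preimage into those counted for [C]: [nn]
    keeps it inside X_n, and [C], having radius [w], does not separate [psi (rho x)] from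
    [rho (block_extend psi x)]. *)
Lemma periodic_mean_preimage s w psi phi C :
  (s.*2.*2 < n)%N -> ((w + s).*2 < n)%N ->
  (forall x, locally X n x -> agree n.-1./2 x (set_val (rho x))) ->
  (forall x, locally X n x -> locally X (n + s.*2) x) ->
  block_code s psi -> block_code s phi -> cancel psi phi ->
  (forall x y, sagree w x y -> C x -> C y) ->
  periodic_mean (psi @^-1` C) <= periodic_mean C.
Proof.
move=> sn wn rhoP nn psis phis psiK wC.
rewrite ler_wpM2r ?invr_ge0// ler_nat.
pose Psi (f : {ffun 'I_p.+1 -> A}) :=
  [ffun j : 'I_p.+1 => block_extend rho psi (periodic_extend f) j].
have PsiE f : periodic_extend (Psi f) =
    block_extend rho psi (periodic_extend f).
  apply: periodic_extendK; apply: block_extend_periodic.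
  exact: translate_periodic_extend.
rewrite -(@card_in_imset _ _ Psi); last first.
  move=> f g; rewrite !inE => /andP[/asboolP fn _] /andP[/asboolP gn _] fg.
  have /(block_extend_inj sn rhoP psis phis psiK fn gn) fgE :
    block_extend rho psi (periodic_extend f) =
    block_extend rho psi (periodic_extend g) by rewrite -!PsiE fg.
  apply/ffunP => j; have := congr1 (@^~ j%:Z) fgE.
  have jp : (j%:Z %% p.+1)%Z = j%:Z by rewrite modz_small//= ltz_nat ltn_ord.
  by rewrite /periodic_extend jp /= inord_val.
apply: subset_leq_card; apply/fintype.subsetP => g /imsetP[f + ->].
rewrite !inE => /andP[/asboolP fn /asboolP Cf].
rewrite PsiE; apply/andP; split; apply/asboolP.
  exact: (locally_block_extend sn rhoP psis (nn _ fn)).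
exact: wC (block_extend_agree sn rhoP psis (nn _ fn) wn) Cf.
Qed.

End PeriodicMean.

(** Compactness of the interval gives a cluster point, and an ultrafilter converges to each of its
    cluster points. *)
Lemma ultra_cvg_itv (R : realType) (U : set_system nat) (u : nat -> R)
    (a b : R) :
  UltraFilter U -> (forall k, a <= u k <= b) -> cvg (u @ U).
Proof.
move=> UU uab; have [|l [_ ul]] := @segment_compact R a b (u @ U) _.
  apply: (@filterS _ U _ setT) => [k _|]; last exact: filterT.
  by rewrite /= in_itv/=; exact: uab.
apply/cvg_ex; exists l => V lV.
have [//|nV] := in_ultra_setVsetC (u @^-1` V) UU.
by have [r []] := ul (~` V) V nV lV.
Qed.

(** * Runs in sets of density 1 *)

Lemma window_countD (S : set nat) m n k :
  window_count S (m + n) k =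
  (window_count S m k + window_count S n (k + m))%N.
Proof. by rewrite /window_count iotaD count_cat. Qed.

Lemma window_count_le (S : set nat) n k : (window_count S n k <= n)%N.
Proof. by rewrite -[X in (_ <= X)%N](size_iota k) count_size. Qed.

(** Each of [n %/ L] disjoint blocks of length [L] misses a point of [S]. *)
Lemma window_count_gap (S : set nat) L :
  (forall k, exists2 j, (k <= j < k + L)%N & ~ S j) ->
  forall n k, (window_count S n k + n %/ L <= n)%N.
Proof.
move=> gap; have gapL k : (window_count S L k < L)%N.
  rewrite ltn_neqAle window_count_le andbT -[X in _ != X](size_iota k).
  rewrite -all_count; apply/negP => /allP SL.
  have [j jL] := gap k; apply; apply/asboolP/SL.
  by rewrite mem_iota.
have L0 : (0 < L)%N by exact: leq_ltn_trans (gapL 0%N).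
move=> n k; rewrite [in X in (X + _)%N](divn_eq n L) [leqRHS](divn_eq n L).
elim: (n %/ L)%N k => [|q IHq] k.
  by rewrite !mul0n !add0n addn0 window_count_le.
rewrite mulSn -addnA window_countD.
by have := gapL k; have := IHq (k + L)%N; lia.
Qed.

Lemma banach_density1_run (R : realType) (S : set nat) (L : nat) :
  upper_banach_density R S = 1 ->
  exists k, forall j, (k <= j < k + L)%N -> S j.
Proof.
move=> dS; apply: contrapT => /forallNP nS.
have gap k : exists2 j, (k <= j < k + L)%N & ~ S j.
  by have /existsNP[j /not_implyP[]] := nS k; exists j.
have L0 : (0 < L)%N by have [j] := gap 0%N; lia.
move: dS; rewrite /upper_banach_density; set u := (X in limn_sup X) => dS.
have u_nonempty n :
    [set ((window_count S n k)%:R / n%:R : R) | k in [set: nat]] !=set0.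
  by exists ((window_count S n 0)%:R / n%:R); exists 0%N.
have w1 n k : (window_count S n k)%:R / n%:R <= 1 :> R.
  have [->|n0] := posnP n; first by rewrite invr0 mulr0.
  by rewrite ler_pdivrMr ?ltr0n// mul1r ler_nat window_count_le.
have u1 n : u n <= 1 by apply: ge_sup => // _ [k _ <-].
have u0 n : 0 <= u n.
  apply: (@le_trans _ _ ((window_count S n 0)%:R / n%:R)).
    by rewrite divr_ge0.
  by apply: ub_le_sup; [exists 1 => _ [k _ <-]|exists 0%N].
(* For n >= L the quotient [n %/ L] is positive, hence at least n / (2L); this is where the constant
   comes from. *)
have uc n : (L <= n)%N -> u n <= 1 - (L.*2)%:R^-1.
  move=> Ln; apply: ge_sup => // _ [k _ <-].
  have n0 : (0 < n)%N by lia.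
  have q2 : (n <= (n %/ L) * L.*2)%N.
    have := divn_eq n L; have := ltn_pmod n L0.
    have : (0 < n %/ L)%N by rewrite divn_gt0.
    nia.
  rewrite ler_pdivrMr ?ltr0n// mulrBl mul1r lerBrDr.
  apply: (@le_trans _ _ ((window_count S n k)%:R + (n %/ L)%:R)).
    rewrite lerD2l mulrC ler_pdivrMr ?ltr0n ?double_gt0// -natrM ler_nat//.
  by rewrite -natrD ler_nat window_count_gap.
have bu : bounded_fun u.
  exists 1; split=> // M M1 n _ /=; rewrite ger0_norm ?u0//.
  exact: le_trans (u1 n) (ltW M1).
have : (1 : R) <= 1 - (L.*2)%:R^-1.
  rewrite -{1}dS limn_supE//; apply: (@le_trans _ _ (sups u L)).
    by apply: ge_inf; [exact: bounded_fun_has_lbound_sups|exists L].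
  by apply: ge_sup => [|_ [n Ln <-]]; [exists (u L), L => /=|exact: uc].
by rewrite lerBrDr gerDl invr_le0 lern0 double_eq0; lia.
Qed.

Lemma stable_run (R : realType) (A : finType) (X : subshift A) (k : nat) :
  language_stable R X -> exists n, (k <= n)%N /\
    forall j, (n < j <= n + k)%N -> minimal_forbidden X j = set0.
Proof.
(* In a run of length 2k + 1, moving [k] places on makes the start at least [k] and leaves [k]
   further lengths. *)
move=> /(@banach_density1_run _ _ (k + k).+1)[n nS]; exists (n + k)%N.
by split=> [|j jnk]; [exact: leq_addl|apply: nS; lia].
Qed.

(** * The invariant mean and the characteristic measure *)

Section Characteristic.
Context (R : realType) (A : finType) (X : subshift A).
Context (X0 : (X : set (fullshift A)) !=set0) (hX : language_stable R X).

(** For positive [n], [n.-1./2] is the largest radius whose window has length at most [n]. For n = 0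
    it is 0, and that window, of length 1, is too long; hence the premise [0 < n]. *)
Lemma exists_local_point (n : nat) : exists rho : fullshift A -> X,
  forall x, (0 < n)%N -> locally X n x -> agree n.-1./2 x (set_val (rho x)).
Proof.
suff /choice[rho rhoP] : forall x, exists y : X,
    (0 < n)%N -> locally X n x -> agree n.-1./2 x (set_val y).
  by exists rho.
move=> x.
have [x0 Xx0] := X0.
have [[n0 xn]|nxn] := pselect ((0 < n)%N /\ locally X n x); last first.
  by exists (exist _ x0 (mem_set Xx0)) => n0 xn; case: nxn.
have [|y xy] := @locally_agree _ _ n n.-1./2 x xn _ 0; first by lia.
by exists y => _ _ i /xy <-; rewrite /translate addr0.
Qed.

Lemma automorphism_code (psi : X -> X) : automorphism psi ->
  exists phi s, [/\ cancel psi phi, block_code s psi & block_code s phi].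
Proof.
move=> [[cpsi [phi [cphi psiK phiK]]] psiS]; exists phi.
have [s psis] := continuous_block_code cpsi.
have [t phit] := continuous_block_code cphi.
exists (maxn s t); split=> //; split=> //.
- by move=> x y xy; apply: psis; apply: agree_le xy; exact: leq_maxl.
- by move=> x; apply: (can_inj psiK); rewrite /= phiK [RHS]psiS /= phiK.
- by move=> x y xy; apply: phit; apply: agree_le xy; exact: leq_maxr.
Qed.

Lemma exists_asymptotic_means : exists mu_ : nat -> set X -> R,
  [/\ forall k C, 0 <= mu_ k C <= 1, forall k, mu_ k setT = 1,
      forall k C D, C `&` D = set0 -> mu_ k (C `|` D) = mu_ k C + mu_ k D &
      forall psi C, automorphism psi -> windowed C ->
        \forall k \near \oo, mu_ k (psi @^-1` C) <= mu_ k C].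
Proof.
have /choice[n nP] : forall k, exists n, (k <= n)%N /\
    forall j, (n < j <= n + k)%N -> minimal_forbidden X j = set0.
  by move=> k; exact: stable_run hX.
have /choice[rho rhoP] := exists_local_point.
have /choice[p pP] : forall k, exists p, exists x,
    locally X (n k) x /\ translate p.+1%:Z x = x.
  by move=> k; exact: exists_periodic X0.
exists (fun k => periodic_mean R (n k) (p k) (rho (n k))); split.
- by move=> k C; rewrite periodic_mean_ge0 periodic_mean_le1.
- by move=> k; have [x [xn xp]] := pP k; exact: periodic_meanT xp xn.
- by move=> k C D; exact: periodic_meanU.
- move=> psi C /automorphism_code[phi [s [psiK psis phis]]] [w wC].
  (* The threshold ensures 4s < n, 2(w + s) < n and 2s <= k for n = [n k], which is at least [k]. *)
  exists (s.*2.*2 + w.*2).+1 => // k /= sk; have [kn nk] := nP k.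
  apply: (@periodic_mean_preimage R A X _ _ _ s w psi phi) => //.
  + by lia.
  + by lia.
  + by move=> x xn; apply: rhoP => //; lia.
  + by move=> x xn; apply: locally_run xn => j jn; apply: nk; lia.
Qed.

(** Along an ultrafilter all the means converge at once; it refines the filter at infinity, so
    eventual inequalities pass to the limit. *)
Lemma exists_invariant_mean : exists m : set X -> R,
  [/\ forall C, 0 <= m C, m setT = 1,
      forall C D, C `&` D = set0 -> m (C `|` D) = m C + m D &
      forall psi C, automorphism psi -> windowed C -> m (psi @^-1` C) = m C].
Proof.
have [mu_ [mu01 muT muU mu_le]] := exists_asymptotic_means.
have [U [UU ooU]] := @ultraFilterLemma nat \oo _.
have cmu C : cvg (mu_ ^~ C @ U).
  by apply: (@ultra_cvg_itv R U _ 0 1) => k; exact: mu01.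
pose m C := lim (mu_ ^~ C @ U).
have m_eq C (l : R) : mu_ ^~ C @ U --> l -> m C = l.
  by move=> Cl; apply: cvg_lim.
have mT : m setT = 1.
  apply: m_eq; rewrite (_ : mu_ ^~ setT = cst 1); first exact: cvg_cst.
  exact/funext.
have mU C D : C `&` D = set0 -> m (C `|` D) = m C + m D.
  move=> CD; apply: m_eq; rewrite (_ : mu_ ^~ _ = mu_ ^~ C \+ mu_ ^~ D).
    exact: cvgD (cmu C) (cmu D).
  by apply/funext => k; rewrite muU.
have mC C : m (~` C) = 1 - m C.
  by rewrite -mT -(setUCr C) mU ?setICr// addrC addKr.
have m_le psi C : automorphism psi -> windowed C -> m (psi @^-1` C) <= m C.
  by move=> psia wC; apply: ler_lim => //; apply: ooU; exact: mu_le.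
exists m; split=> // [C|psi C psia wC].
  by apply: limr_ge => //; apply: nearW => k; have /andP[] := mu01 k C.
apply/le_anti/andP; split; first exact: m_le.
(* The inequality for the complement is the reverse inequality for [C]. *)
have := m_le psi (~` C) psia (windowedC wC).
by rewrite preimage_setC !mC lerD2l lerN2.
Qed.

End Characteristic.

Theorem theorem1p1 (R : realType) (A : finType) (X : subshift A)
    (X0 : (X : set (fullshift A)) !=set0) (hX : language_stable R X) :
  exists mu : probability (borel X0) R,
    forall psi : X -> X, automorphism psi ->
      forall B : set (borel X0), measurable B ->
        pushforward mu (psi : borel X0 -> borel X0) B = mu B.
Proof.
have [m [m_ge0 mT mU minv]] := exists_invariant_mean X0 hX.
have [mu muE] := window_extension X0 m_ge0 mT mU.
exists mu => psi psia B mB.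
have [[cpsi _] psiS] := psia.
have mpsi : measurable_fun setT (psi : borel X0 -> borel X0).
  apply: (@measurability _ _ (borel X0) (borel X0) setT psi
    (@open (points X0))); first by [].
  move=> _ [V oV <-]; rewrite setTI; apply: sub_sigma_algebra.
  by apply: open_comp => // x _; exact: cpsi.
have wmeas : @windowed A X `<=` @measurable _ (borel X0).
  by move=> C /windowed_open oC; exact: sub_sigma_algebra.
have wT : windowed [set: X] by exists 0%N.
(* Window sets are closed under intersection and generate the Borel sets, so it suffices to compare
   the two measures on them, where the invariance of [m] applies. *)
apply: (@g_sigma_algebra_measure_unique _ R (borel X0) (@windowed A X) wmeas
  (fun=> setT) _ _ (pushforward mu (psi : borel X0 -> borel X0)) mu) => //.
- by rewrite bigcup_const.
- exact: (@measurableI _ (window_space X0)).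
- move=> C wC; have := muE _ (windowed_preimage cpsi psiS wC).
  by rewrite minv// => muC; exact: etrans muC (esym (muE C wC)).
- by move=> _; rewrite [ltLHS](probability_setT mu) ltry.
- by rewrite sigma_windowed.
Qed.
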